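(* Let $q$ be an integer with $0<q<\infty$, let $C^q[0,1]$ be the Banach space of $q$ times continuously differentiable real-valued functions on $[0,1]$ with the norm $\|x\|_q=\max_{0\le j\le q}\sup_{t\in[0,1]}|x^{(j)}(t)|$, and let $Y$ be a real linear topological space. Then every bounded-differentiable germ at $0\in C^q[0,1]$ into $Y$ has a global bounded-differentiable representative, and every compact-differentiable germ at $0\in C^q[0,1]$ into $Y$ has a global compact-differentiable representative.
   Context: Differentiability. A map $f$ from a neighborhood of $x$ in a linear topological space $X$ to a linear topological space $Y$ is differentiable at $x$ if there is a continuous linear $A:X\to Y$ such that, with $r(h)=f(x+h)-f(x)-Ah$: (i) bounded differentiability: for every bounded set $S\subset X$, $r(th)/t\to 0$ as $t\to 0$ ($t\in\mathbb{R}$), uniformly in $h\in S$; (ii) compact (Hadamard) differentiability: $f(x+t_nh_n)-f(x)=t_nAh+o(t_n)$ whenever $t_n\to 0$ in $\mathbb{R}$ and $h_n\to h$ in $X$. A map is differentiable on a set if it is differentiable at every point of it. Germs. A germ at $0\in X$ into $Y$ is an equivalence class of maps into $Y$ defined on neighborhoods of $0$, any two of which coincide on some neighborhood of $0$; its elements are called representatives. A germ is differentiable (in a given sense) if it has a representative differentiable in that sense on a neighborhood of $0$. A global differentiable representative is a representative defined and differentiable (in that sense) on all of $X$. *)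

(* Defs.v *)
From HB Require Import structures.
From mathcomp Require Import all_boot all_order all_algebra.
From mathcomp Require Import all_classical all_reals all_analysis.
From mathcomp Require Import ring lra.

Set Implicit Arguments.
Unset Strict Implicit.
Unset Printing Implicit Defensive.

Import Order.TTheory GRing.Theory Num.Theory.
Import numFieldNormedType.Exports.

Local Open Scope classical_set_scope.
Local Open Scope ring_scope.

Section Differentiability.
Context {R : realType} {X Y : topologicalLmodType R}.

Definition tvs_bounded (S : set X) : Prop :=
  forall U : set X, nbhs 0 U ->
    exists2 s : R, 0 < s & forall t : R, s < t -> S `<=` [set t *: u | u in U].

(* A map defined on [D] is given by a total function of which only the values
   on [D] are meant.  Differentiability at [x] asks [D] to be a neighborhood
   of [x], so that it does not depend on the values off [D]. *)

Definition bounded_differentiable_at (D : set X) (f : X -> Y) (x : X) : Prop :=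
  nbhs x D /\
  exists2 A : {linear X -> Y}, continuous A &
    let r h := f (x + h) - f x - A h in
    forall S : set X, tvs_bounded S -> forall W : set Y, nbhs 0 W ->
      \forall t \near (0 : R)^', forall h : X, S h -> W (t^-1 *: r (t *: h)).

(* The factor [e] renders [o(t_n)] in such a way that [t_ n = 0] is allowed. *)
Definition compact_differentiable_at (D : set X) (f : X -> Y) (x : X) : Prop :=
  nbhs x D /\
  exists2 A : {linear X -> Y}, continuous A &
    forall (t_ : nat -> R) (h_ : nat -> X) (h : X),
      t_ n @[n --> \oo] --> (0 : R) -> h_ n @[n --> \oo] --> h ->
      exists2 e : nat -> Y, e n @[n --> \oo] --> (0 : Y) &
        \forall n \near \oo,
          f (x + t_ n *: h_ n) - f x = t_ n *: A h + t_ n *: e n.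

End Differentiability.

Section Germs.
Context {R : realType} (X Y : topologicalLmodType R).

Record local_map := LocalMap {
  lm_dom : set X ;
  lm_fun :> X -> Y ;
  lm_dom_nbhs : nbhs 0 lm_dom }.

Definition same_germ (f g : local_map) : Prop :=
  exists2 V : set X, nbhs 0 V &
    forall x, V x -> [/\ lm_dom f x, lm_dom g x & f x = g x].

Record germ := Germ {
  representative : set local_map ;
  germ_classP : exists f, representative = [set g | same_germ f g] }.

End Germs.

Section GermDifferentiability.
Context {R : realType} {X Y : topologicalLmodType R}.

Variable diff_at : set X -> (X -> Y) -> X -> Prop.

Definition differentiable_germ (G : germ X Y) : Prop :=
  exists2 f, representative G f &
    exists2 V : set X, nbhs 0 V & forall x, V x -> diff_at (lm_dom f) f x.

Definition has_global_differentiable_representative (G : germ X Y) : Prop :=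
  exists f, [/\ representative G f, lm_dom f = setT &
    forall x, diff_at (lm_dom f) f x].

End GermDifferentiability.

Notation I01 R := (set_type (`[0, 1]%classic : set R)).

Section Derivatives01.
Context {R : realType}.
Local Notation I01 := (I01 R).

(* Derivatives are taken within [0,1], hence are one-sided at 0 and 1. *)
Definition diff_quot01 (f : I01 -> R) (t s : I01) : R :=
  (f s - f t) / (\val s - \val t).

Definition derivable01 (f : I01 -> R) (t : I01) : Prop :=
  cvg (diff_quot01 f t s @[s --> t^']).

Definition deriv01 (f : I01 -> R) (t : I01) : R :=
  lim (diff_quot01 f t s @[s --> t^']).

Definition derivn01 (j : nat) (f : I01 -> R) : I01 -> R := iter j deriv01 f.

Definition is_Cq (q : nat) (f : I01 -> R) : Prop :=
  (forall j, (j < q)%N -> forall t, derivable01 (derivn01 j f) t) /\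
  continuous (derivn01 q f).

Definition sup_norm01 (f : I01 -> R) : R := sup (range (fun t => `|f t|)).

Definition Cq_norm (q : nat) (f : I01 -> R) : R :=
  \big[Num.max/0]_(j < q.+1) sup_norm01 (derivn01 j f).

Lemma I01_val_cvg (t : I01) : (\val s @[s --> t] --> \val t).
Proof. exact: (@initial_continuous _ _ (@set_val R `[0,1]%classic)). Qed.

Lemma I01_dnbhs_proper (t : I01) : ProperFilter t^'.
Proof.
split; last exact: dnbhs_filter.
rewrite /dnbhs /within/= => -[B [[W oW <-]/= Wt] sB].
have /nbhs_ballP[e/= e0 eW] : nbhs (\val t) W by exact: open_nbhs_nbhs.
have /andP[t0 t1] : 0 <= \val t <= 1.
  by have := set_valP t; rewrite /= in_itv/=.
pose d := Num.min (e / 2) (1 / 2).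
have d0 : 0 < d by rewrite lt_min !divr_gt0.
have de : d < e by rewrite gt_min; apply/orP; left; lra.
have d2 : d <= 1 / 2 by rewrite ge_min lexx orbT.
pose u := if \val t <= 1 / 2 then \val t + d else \val t - d.
have ut : `|\val t - u| = d.
  rewrite /u; case: ifPn => _; first by rewrite opprD addNKr normrN gtr0_norm.
  by rewrite opprB addrC subrK gtr0_norm.
have Iu : `[0, 1]%classic u.
  by rewrite /= in_itv/= /u; case: ifPn; rewrite -?ltNge => h; apply/andP; split; lra.
have Wu : W u by apply: eW; rewrite /ball/= ut.
have := sB (SigSub (mem_set Iu)) Wu.
apply; apply/eqP => /(congr1 val)/= E.
by move: ut; rewrite (E : u = \val t) subrr normr0 => d00; rewrite d00 ltxx in d0.
Qed.

#[local] Existing Instance I01_dnbhs_proper.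

Lemma diff_quot01_lin (a : R) (f g : I01 -> R) (t : I01) :
  diff_quot01 (a *: f + g) t =
  (fun s => a * diff_quot01 f t s + diff_quot01 g t s).
Proof.
apply/funext => s; rewrite /diff_quot01.
have E u : (a *: f + g) u = a * f u + g u by [].
by rewrite !E mulrA -mulrDl; congr (_ / _); ring.
Qed.

Lemma derivable01_lin (a : R) (f g : I01 -> R) (t : I01) :
  derivable01 f t -> derivable01 g t ->
  derivable01 (a *: f + g) t /\
  deriv01 (a *: f + g) t = a * deriv01 f t + deriv01 g t.
Proof.
rewrite /derivable01 /deriv01 => df dg; rewrite diff_quot01_lin.
have h : a * diff_quot01 f t s + diff_quot01 g t s @[s --> t^'] -->
    a * deriv01 f t + deriv01 g t.
  by apply: cvgD => //; apply: cvgM => //; exact: cvg_cst.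
by split; [apply/cvg_ex; eexists; exact: h|exact: (cvg_lim _ h)].
Qed.

Lemma derivable01_continuous (f : I01 -> R) (t : I01) :
  derivable01 f t -> {for t, continuous f}.
Proof.
rewrite /derivable01 => df.
have vt : \val s @[s --> t^'] --> \val t.
  by apply: cvg_within_filter; exact: I01_val_cvg.
have h : f t + diff_quot01 f t s * (\val s - \val t) @[s --> t^'] -->
    f t + deriv01 f t * (\val t - \val t).
  apply: cvgD; first exact: cvg_cst.
  by apply: cvgM => //; apply: cvgB => //; exact: cvg_cst.
rewrite subrr mulr0 addr0 in h.
have {}h : f s @[s --> t^'] --> f t.
  apply: cvg_trans h; apply: near_eq_cvg; near=> s.
  have st : s != t by near: s; exact: nbhs_dnbhs_neq.
  have vst : \val s - \val t != 0.
    by rewrite subr_eq0; apply: contra st => /eqP/val_inj ->.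
  suff -> : diff_quot01 f t s * (\val s - \val t) = f s - f t.
    exact: subrKC.
  exact: divfK.
move=> W fW; have := h W fW; rewrite !nbhs_simpl/= /dnbhs /within/=.
apply: filterS => s /=; have [->|st] := eqVneq s t; last exact.
by move=> _; exact: nbhs_singleton.
Unshelve. all: by end_near. Qed.

Lemma is_Cq_cont q (f : I01 -> R) j : is_Cq q f -> (j <= q)%N ->
  continuous (derivn01 j f).
Proof.
move=> [df cf]; rewrite leq_eqVlt => /predU1P[->//|jq] t.
exact/derivable01_continuous/df.
Qed.

Lemma derivn01_lin q a (f g : I01 -> R) j : is_Cq q f -> is_Cq q g ->
  (j <= q)%N -> derivn01 j (a *: f + g) = a *: derivn01 j f + derivn01 j g.
Proof.
move=> [df cf] [dg cg]; elim: j => [//|j IHj] jq.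
rewrite /derivn01 !iterS -!/(derivn01 _ _) IHj ?(ltnW jq)//.
by apply/funext => t; have [] := derivable01_lin a (df _ jq t) (dg _ jq t).
Qed.

Lemma is_Cq_lin q a (f g : I01 -> R) : is_Cq q f -> is_Cq q g ->
  is_Cq q (a *: f + g).
Proof.
move=> Cf Cg; split=> [j jq t|].
  rewrite (derivn01_lin a Cf Cg (ltnW jq)).
  by have [] := derivable01_lin a (Cf.1 _ jq t) (Cg.1 _ jq t).
rewrite (derivn01_lin a Cf Cg (leqnn q)).
rewrite (_ : _ + _ = fun u => a * derivn01 q f u + derivn01 q g u)// => t.
have F : Filter (nbhs t) by exact: nbhs_filter.
exact: (cvgD (FF := F) (cvgMl_tmp (FF := F) (Cf.2 t)) (Cg.2 t)).
Qed.

Lemma derivn01_0 j : derivn01 j 0 = 0 :> (I01 -> R).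
Proof.
have d0 (t : I01) : diff_quot01 0 t = cst 0.
  by apply/funext => s; rewrite /diff_quot01 subrr mul0r.
elim: j => [//|j IHj]; rewrite /derivn01 iterS -/(derivn01 _ _) IHj.
by apply/funext => t; rewrite /deriv01 d0; apply: cvg_lim => //; exact: cvg_cst.
Qed.

Lemma is_Cq0 q : is_Cq q (0 : I01 -> R).
Proof.
split=> [j _ t|]; rewrite derivn01_0; last exact: cst_continuous.
rewrite /derivable01 (_ : diff_quot01 0 t = cst 0); first exact: is_cvg_cst.
by apply/funext => s; rewrite /diff_quot01 subrr mul0r.
Qed.

Lemma continuous01_bounded (f : I01 -> R) : continuous f ->
  has_ubound (range (fun t => `|f t|)).
Proof.
move=> /subspace_valL_continuousP cf.
have := continuous_compact cf (@segment_compact R 0 1).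
move=> /compact_bounded[M [_ /(_ (M + 1))]]; rewrite ltrDl ltr01 => /(_ isT) fM.
exists (M + 1) => _ [t _ <-]; apply: fM => /=.
exists (\val t); first by have := set_valP t.
exact: (congr1 (fun g : I01 -> R => g t) (valLK point f)).
Qed.

Lemma le_sup_norm01 (f : I01 -> R) t : continuous f -> `|f t| <= sup_norm01 f.
Proof.
by move=> cf; apply: ub_le_sup; [exact: continuous01_bounded|exists t].
Qed.

Lemma sup_norm01_le (f : I01 -> R) M : (forall t, `|f t| <= M) ->
  sup_norm01 f <= M.
Proof.
move=> fM; apply: ge_sup => [|_ [t _ <-]//].
have I0 : `[0, 1]%classic (0 : R) by rewrite /= in_itv/= lexx ler01.
by exists `|f (SigSub (mem_set I0))|; exists (SigSub (mem_set I0)).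
Qed.

Lemma sup_norm01_ge0 (f : I01 -> R) : continuous f -> 0 <= sup_norm01 f.
Proof.
have I0 : `[0, 1]%classic (0 : R) by rewrite /= in_itv/= lexx ler01.
by move=> cf; apply: le_trans (le_sup_norm01 (SigSub (mem_set I0)) cf).
Qed.

Lemma Cq_norm_ge (q : nat) (f : I01 -> R) j t : is_Cq q f -> (j <= q)%N ->
  `|derivn01 j f t| <= Cq_norm q f.
Proof.
move=> Cf jq; apply: le_trans (le_sup_norm01 t (is_Cq_cont Cf jq)) _.
by apply: (le_bigmax _ (fun j : 'I_q.+1 => sup_norm01 (derivn01 j f))
  (Ordinal (jq : (j < q.+1)%N))).
Qed.

Lemma Cq_norm_ge0 (q : nat) (f : I01 -> R) : 0 <= Cq_norm q f.
Proof. exact: bigmax_ge_id. Qed.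

Lemma Cq_norm_le (q : nat) (f : I01 -> R) M : 0 <= M ->
  (forall j t, (j <= q)%N -> `|derivn01 j f t| <= M) -> Cq_norm q f <= M.
Proof.
move=> M0 fM; apply: bigmax_le => // j _; apply: sup_norm01_le => t.
by apply: fM; rewrite -ltnS.
Qed.

End Derivatives01.

Section CqSpace.
Context (R : realType) (q : nat).

Definition Cq_pred : {pred (I01 R -> R)} := mem [set f | is_Cq q f].

Record Cq := MkCq { Cq_fun :> I01 R -> R ; _ : Cq_fun \in Cq_pred }.

HB.instance Definition _ := [isSub for Cq_fun].
HB.instance Definition _ := [Choice of Cq by <:].

Lemma Cq_submod_closed : submod_closed Cq_pred.
Proof.
split=> [|a f g]; first by apply/mem_set/is_Cq0.
by move=> /set_mem Cf /set_mem Cg; apply/mem_set/is_Cq_lin.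
Qed.

HB.instance Definition _ :=
  GRing.isSubmodClosed.Build _ _ Cq_pred Cq_submod_closed.
HB.instance Definition _ := [SubChoice_isSubLmodule of Cq by <:].

Definition norm_Cq (x : Cq) : R := Cq_norm q x.

Lemma Cq_funP (x : Cq) : is_Cq q x.
Proof. by apply: set_mem; exact: valP x. Qed.

Lemma norm_CqD (x y : Cq) : norm_Cq (x + y) <= norm_Cq x + norm_Cq y.
Proof.
apply: Cq_norm_le => [|j t jq]; first by rewrite addr_ge0 ?Cq_norm_ge0.
have -> : derivn01 j (x + y : Cq) = derivn01 j x + derivn01 j y.
  rewrite -[derivn01 j x]scale1r -(derivn01_lin _ (Cq_funP x) (Cq_funP y) jq).
  by rewrite scale1r.
rewrite (le_trans (ler_normD _ _))// lerD//; exact: Cq_norm_ge (Cq_funP _) jq.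
Qed.

Lemma derivn01Z (l : R) (x : Cq) j : (j <= q)%N ->
  derivn01 j (l *: x : Cq) = l *: derivn01 j x.
Proof.
move=> jq; rewrite -[RHS]addr0 -[X in _ = _ + X](derivn01_0 j).
by rewrite -(derivn01_lin _ (Cq_funP x) (is_Cq0 q) jq) addr0.
Qed.

Lemma norm_CqZ (l : R) (x : Cq) : norm_Cq (l *: x) = `|l| * norm_Cq x.
Proof.
have le_normZ (a : R) (y : Cq) : norm_Cq (a *: y) <= `|a| * norm_Cq y.
  apply: Cq_norm_le => [|j t jq]; first by rewrite mulr_ge0 ?Cq_norm_ge0.
  rewrite derivn01Z// normrM ler_wpM2l//; exact: Cq_norm_ge (Cq_funP _) jq.
apply/eqP; rewrite eq_le le_normZ/=.
have [->|l0] := eqVneq l 0; first by rewrite normr0 mul0r Cq_norm_ge0.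
rewrite -ler_pdivlMl ?normr_gt0// -normfV.
by rewrite (le_trans _ (le_normZ _ _))// scalerA mulVf// scale1r.
Qed.

Lemma norm_Cq0_eq0 (x : Cq) : norm_Cq x = 0 -> x = 0.
Proof.
move=> x0; apply/val_inj/funext => t; apply/eqP; rewrite -normr_le0.
by apply: le_trans (Cq_norm_ge t (Cq_funP x) (leq0n q)) _; rewrite -/(norm_Cq x) x0.
Qed.

HB.instance Definition _ :=
  Lmodule_isNormed.Build R Cq norm_CqD norm_CqZ norm_Cq0_eq0.

End CqSpace.

(* Main.v *)
Require Import Defs.
From HB Require Import structures.
From mathcomp Require Import all_boot all_order all_algebra.
From mathcomp Require Import all_classical all_reals all_analysis.
From mathcomp Require Import ring lra.

(** A germ extends as soon as a neighborhood of 0 can be mapped into itself by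
    the whole space without moving the points near 0: if [f] represents the
    germ and is differentiable on the ball of radius [d], and if [H] is a
    differentiable map of the space into that ball with [H x = x] near 0, then
    [f \o H] is defined and differentiable everywhere and has the same germ
    ([global_representative]).  Such a map [H] is a bounded local identity, a
    blid for short.  Spaces such as C[0,1] have blids although they have no
    differentiable bump functions.

    On continuous functions a blid is given by composition with a bounded
    scalar function [eta] that is the identity near 0.  On C^q the composition
    [eta \o x] is not bounded, since its derivatives involve those of [x].
    But C^q is isomorphic to R^q x C[0,1] through
      x |-> (x(0), x'(0), ..., x^(q-1)(0), x^(q)),
    and in these coordinates [eta] can be applied to each component
    ([small_blids_Cq]).  The coordinates determine [x] with norm control by
    the mean value theorem ([Cq_norm_jet_le]), and can be prescribed by the
    fundamental theorem of calculus ([exists_jet]).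

    The scalar function ([soft_clamp]) is piecewise quadratic, so that its
    first-order Taylor remainder is bounded by a multiple of [b ^+ 2],
    uniformly in the base point ([soft_clamp_quadratic]).  The remainder of
    the blid is then bounded by a multiple of the squared norm, with no
    compactness argument, which makes the blid bounded-differentiable, and
    compact-differentiable as well because its domain is normed.  It remains
    to compose: both notions satisfy a chain rule
    ([bounded_differentiable_comp], [compact_differentiable_comp]). *)

Set Implicit Arguments.
Unset Strict Implicit.
Unset Printing Implicit Defensive.

Import Order.TTheory GRing.Theory Num.Theory.
Import numFieldNormedType.Exports.

Local Open Scope classical_set_scope.
Local Open Scope ring_scope.

(** * Chain rules in topological vector spaces *)

Section TVS.
Context {R : realType}.

Lemma nbhs0_split (Y : topologicalLmodType R) (W : set Y) : nbhs 0 W ->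
  exists2 V : set Y, nbhs 0 V & forall u v, V u -> V v -> W (u + v).
Proof.
move=> W0; have [|[P Q] /= [P0 Q0] PQ] := @add_continuous Y (0, 0) W.
  by rewrite /= addr0.
exists (P `&` Q); first exact: filterI.
by move=> u v [Pu _] [_ Qv]; exact: (PQ (u, v)).
Qed.

Lemma linear_cvg0 (X Y : topologicalLmodType R) (A : {linear X -> Y}) :
  continuous A -> forall V : set Y, nbhs 0 V -> nbhs 0 (A @^-1` V).
Proof. by move=> cA V V0; apply: cA; rewrite linear0. Qed.

Lemma linear_comp_continuous (X Y Z : topologicalLmodType R)
    (A : {linear X -> Y}) (B : {linear Y -> Z}) :
  continuous A -> continuous B -> continuous (B \o A).
Proof. by move=> cA cB x; apply: continuous_comp; [exact: cA|exact: cB]. Qed.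

Lemma tvs_bounded_linear_norm (X : topologicalLmodType R) (E : normedModType R)
    (A : {linear X -> E}) (S : set X) : continuous A -> tvs_bounded S ->
  exists M : R, forall h, S h -> `|A h| <= M.
Proof.
move=> cA bS; have [|s s0 sS] := bS (A @^-1` ball 0 1).
  by apply: linear_cvg0 => //; exact: nbhsx_ballx.
exists (s + 1) => h Sh; have [|u] := sS (s + 1) _ h Sh; first by rewrite ltrDl.
rewrite /= -ball_normE /= sub0r normrN => Au <-.
rewrite linearZ /= normrZ gtr0_norm; last by rewrite addr_gt0.
by rewrite ler_piMr ?addr_ge0 // ltW.
Qed.

Lemma tvs_bounded_norm_le (E : normedModType R) (M : R) :
  tvs_bounded [set h : E | `|h| <= M].
Proof.
move=> U /nbhs_ballP[e /= e0 eU]; exists (`|M| / e + 1) => [|t].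
  by rewrite ltr_pwDr // divr_ge0 // ltW.
move=> st h /= hM; have t0 : 0 < t.
  by apply: le_lt_trans st; rewrite addr_ge0 // divr_ge0 // ltW.
exists (t^-1 *: h); last by rewrite scalerA mulfV ?gt_eqF // scale1r.
apply: eU; rewrite -ball_normE /= sub0r normrN normrZ gtr0_norm ?invr_gt0 //.
rewrite mulrC ltr_pdivrMr // (le_lt_trans hM) // (le_lt_trans (ler_norm M)) //.
rewrite mulrC -ltr_pdivrMr // (lt_trans _ st) // ltrDl //.
Qed.

(** Write [g (x + t *: h) = g x + t *: k] with [k = A h + r], [r] small.  When
    [h] runs over a bounded set, so does [k], because a ball of the
    intermediate space is both bounded and a neighborhood of 0; uniformity of
    the remainder of [f] over bounded sets then applies to [k].  This is why
    the intermediate space is normed. *)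
Lemma bounded_differentiable_comp (X : topologicalLmodType R)
    (E : normedModType R) (Y : topologicalLmodType R)
    (D D1 : set X) (D2 : set E) (g : X -> E) (f : E -> Y) (x : X) :
  nbhs x D -> bounded_differentiable_at D1 g x ->
  bounded_differentiable_at D2 f (g x) ->
  bounded_differentiable_at D (f \o g) x.
Proof.
move=> Dx [_ [A cA dg]] [_ [B cB df]]; split=> //.
exists (B \o A); first exact: linear_comp_continuous.
move=> /= S bS W /nbhs0_split[V V0 VW].
have [M SM] := tvs_bounded_linear_norm cA bS.
have B0 : nbhs 0 (B @^-1` V `&` ball 0 1).
  by apply: filterI; [exact: linear_cvg0|exact: nbhsx_ballx].
have near_g := dg S bS _ B0.
have near_f := df _ (tvs_bounded_norm_le (E := E) (M + 1)) _ V0.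
near=> t.
have t0 : t != 0 by near: t; exact: nbhs_dnbhs_neq.
have Hg := near near_g t; have Hf := near near_f t.
move=> h Sh; have [//|/= Bh] := Hg _ h Sh.
rewrite -ball_normE /= sub0r normrN => rh.
have AE : A (t *: h) = t *: A h by exact: linearZ.
have BE k : B (t *: k) = t *: B k by exact: linearZ.
set r := t^-1 *: _ in Bh rh.
have gE : g (x + t *: h) = g x + t *: (A h + r).
  rewrite /r scalerDr scalerA mulfV // scale1r AE.
  by rewrite -[_ - _ - _]addrA -opprD addrA subrKC.
rewrite [_ *: _](_ : _ = t^-1 *: (f (g x + t *: (A h + r)) - f (g x) -
    B (t *: (A h + r))) + B r); last first.
  rewrite gE AE !BE [B (_ + _)]linearD !scalerBr !scalerA mulVf // !scale1r.
  by rewrite opprD addrA subrK.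
apply: VW => //; apply: Hf => //=.
by rewrite (le_trans (ler_normD _ _)) // lerD ?SM // ltW.
Unshelve. all: by end_near. Qed.

(** The directions [k_n = A h + e_n] along which [g] moves converge to [A h], so
    they are admissible in the definition for [f]. *)
Lemma compact_differentiable_comp (X E Y : topologicalLmodType R)
    (D D1 : set X) (D2 : set E) (g : X -> E) (f : E -> Y) (x : X) :
  nbhs x D -> compact_differentiable_at D1 g x ->
  compact_differentiable_at D2 f (g x) ->
  compact_differentiable_at D (f \o g) x.
Proof.
move=> Dx [_ [A cA dg]] [_ [B cB df]]; split=> //.
exists (B \o A); first exact: linear_comp_continuous.
move=> t_ h_ h t0 h_h.
have [e e0 ge] := dg t_ h_ h t0 h_h.
have ke : A h + e n @[n --> \oo] --> A h.
  rewrite -[X in _ --> X]addr0.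
  apply: (@continuous_cvg _ _ _ _ _ (fun n => (A h, e n))
    (fun z : E * E => z.1 + z.2) (A h, 0)); first exact: add_continuous.
  by apply: cvg_pair => //=; exact: cvg_cst.
have [e' e'0 fe] := df t_ _ _ t0 ke.
exists e' => //; near=> n.
have gn : g (x + t_ n *: h_ n) = g x + t_ n *: (A h + e n).
  by rewrite scalerDr -(near ge n) // subrKC.
by rewrite /= gn (near fe n).
Unshelve. all: by end_near. Qed.

(** A convergent sequence of directions is eventually in a ball, which is
    bounded in a normed space. *)
Lemma bounded_compact_differentiable (E : normedModType R)
    (Y : topologicalLmodType R) (D : set E) (f : E -> Y) (x : E) :
  bounded_differentiable_at D f x -> compact_differentiable_at D f x.
Proof.
move=> [Dx [A cA df]]; split=> //; exists A => // t_ h_ h t0 h_h.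
(* off the indices with t_n = 0 this is the only possible remainder *)
pose e n := if t_ n == 0 then 0 else
  (t_ n)^-1 *: (f (x + t_ n *: h_ n) - f x) - A h.
exists e.
  move=> W W0; have [V V0 VW] := nbhs0_split W0.
  have near_f := df _ (tvs_bounded_norm_le (E := E) (`|h| + 1)) _ V0.
  have hh0 : h_ n - h @[n --> \oo] --> (0 : E) by apply/subr_cvg0.
  have AV : \forall n \near \oo, V (A (h_ n - h)).
    exact: hh0 _ (linear_cvg0 cA V0).
  have hb : \forall n \near \oo, `|h_ n| <= `|h| + 1.
    have : `|h_ n| @[n --> \oo] --> `|h| by exact: cvg_norm.
    move=> /cvgrPdist_le/(_ 1 ltr01).
    apply: filterS => n; rewrite distrC => /(le_trans (ler_norm _)).
    by rewrite lerBlDl.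
  suff : \forall n \near \oo, W (e n) by [].
  have tf : \forall n \near \oo, t_ n != 0 -> forall k, `|k| <= `|h| + 1 ->
      V ((t_ n)^-1 *: (f (x + t_ n *: k) - f x - A (t_ n *: k))).
    exact: t0 _ near_f.
  move: tf AV hb; apply: filterS3 => n tfn AVn hbn.
  rewrite /e; case: (eqVneq (t_ n) 0) => [_|tn0]; first exact: nbhs_singleton.
  rewrite [X in W X](_ : _ = (t_ n)^-1 *: (f (x + t_ n *: h_ n) - f x -
    A (t_ n *: h_ n)) + A (h_ n - h)); last first.
    have -> : A (t_ n *: h_ n) = t_ n *: A (h_ n) by exact: linearZ.
    rewrite [A (_ - _)]linearB [in RHS]scalerBr scalerA mulVf // scale1r.
    by rewrite addrA subrK.
  by apply: VW => //; exact: tfn.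
apply: nearW => n.
rewrite /e; case: (eqVneq (t_ n) 0) => [->|tn0].
  by rewrite !scale0r addr0 subrr addr0.
by rewrite scalerBr scalerA mulfV // scale1r subrKC.
Qed.

Lemma quadratic_bounded_differentiable (E F : normedModType R)
    (g : E -> F) (x : E) (A : {linear E -> F}) (C : R) : continuous A ->
  (forall k, `|g (x + k) - g x - A k| <= C * `|k| ^+ 2) ->
  bounded_differentiable_at setT g x.
Proof.
move=> cA gC; split; first exact: filterT.
exists A => //= S bS W /nbhs_ballP[e /= e0 eW].
have [M SM] := tvs_bounded_linear_norm (A := idfun) (fun x => cvg_id) bS.
near=> t => h Sh; apply: eW; rewrite -ball_normE /= sub0r normrN.
have t0 : t != 0 by near: t; exact: nbhs_dnbhs_neq.
rewrite normrZ normfV.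
have tpos : 0 < `|t| by rewrite normr_gt0.
rewrite mulrC ltr_pdivrMr // (le_lt_trans (gC _)) // normrZ.
rewrite exprMn mulrCA expr2 -mulrA [e * _]mulrC ltr_pM2l //.
have Mh : C * `|h| ^+ 2 <= `|C| * M ^+ 2.
  rewrite (le_trans (ler_norm _)) // normrM ler_wpM2l // normrX normr_id.
  by rewrite ler_pXn2r // ?nnegrE ?(le_trans _ (SM _ Sh)) ?SM.
apply: le_lt_trans (_ : `|t| * (`|C| * M ^+ 2 + 1) < e).
  by rewrite ler_wpM2l // ler_wpDr.
rewrite -ltr_pdivlMr; last by rewrite ltr_wpDl // mulr_ge0 // sqr_ge0.
near: t; apply: dnbhs0_lt; rewrite divr_gt0 // ltr_wpDl // mulr_ge0 // sqr_ge0.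
Unshelve. all: by end_near. Qed.

(** * Global representatives from bounded local identities *)

Lemma same_germ_trans (X Y : topologicalLmodType R) (f g h : local_map X Y) :
  same_germ f g -> same_germ g h -> same_germ f h.
Proof.
move=> [V V0 fg] [W W0 gh]; exists (V `&` W); first exact: filterI.
by move=> x [/fg[? _ ->] /gh[_ ? ->]].
Qed.

(** Bounded local identities at 0 of arbitrarily small range, so that the range
    fits in any given neighborhood of 0. *)
Definition small_blids (E : normedModType R) := forall d : R, 0 < d ->
  exists H : E -> E, [/\ forall x, bounded_differentiable_at setT H x,
    \forall x \near 0, H x = x & forall x, `|H x| < d].

Section global.
Context (E : normedModType R) (Y : topologicalLmodType R).
Variable diff_at : set E -> (E -> Y) -> E -> Prop.
Hypothesis diff_comp : forall (D : set E) (f : E -> Y) (H : E -> E) (x : E),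
  bounded_differentiable_at setT H x -> diff_at D f (H x) ->
  diff_at setT (f \o H) x.

(** The representative is [f \o H], with [H] a blid whose range is in the
    neighborhood on which [f] is differentiable. *)
Lemma global_representative (G : germ E Y) : small_blids E ->
  differentiable_germ diff_at G ->
  has_global_differentiable_representative diff_at G.
Proof.
move=> bE [f Gf [V /nbhs_ballP[d /= d0 dV] Vf]].
have [H [dH H_id Hd]] := bE d d0.
exists (@LocalMap R E Y setT (f \o H) filterT); split=> //=; last first.
  move=> x; apply: diff_comp (dH x) (Vf _ (dV _ _)).
  by rewrite -ball_normE /= sub0r normrN.
have [f0 E0] := germ_classP G; rewrite E0 in Gf *; apply: same_germ_trans Gf _.
exists (lm_dom f `&` [set x | H x = x]).
  by apply: filterI => //; exact: lm_dom_nbhs.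
by move=> x [fx /= Hx]; split => //=; rewrite Hx.
Qed.

End global.
End TVS.

(** * A bounded scalar function that is the identity near 0 *)

Section soft_clamp.
Context {R : realType}.

Definition ramp (u : R) : R := Num.max 0 u.
Definition ramp_primitive (u : R) : R := ramp u ^+ 2 / 2.

Lemma ramp_continuous : continuous ramp.
Proof.
move=> u; apply: (@continuous_max R R (cst 0) id); first exact: cst_continuous.
exact: cvg_id.
Qed.

Lemma ramp_eq0 u : u <= 0 -> ramp u = 0.
Proof. by move=> u0; rewrite /ramp max_l. Qed.

Lemma rampP u : (u <= 0 /\ ramp u = 0) \/ (0 <= u /\ ramp u = u).
Proof. by rewrite /ramp; case: (leP 0 u) => [|/ltW]; [right|left]. Qed.

Lemma ramp_primitive_quadratic a b :
  `|ramp_primitive (a + b) - ramp_primitive a - ramp a * b| <= b ^+ 2 / 2.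
Proof.
rewrite /ramp_primitive ler_norml.
by case: (rampP a) => -[a0 ->]; case: (rampP (a + b)) => -[ab0 ->];
  apply/andP; split; nra.
Qed.

(** The odd C^1 function that is the identity on [[-d, d]], is constant outside
    [[-2d, 2d]], and has an affine derivative on the two intervals between. *)
Definition soft_clamp (d y : R) : R :=
  y + (ramp_primitive (- y - d) - ramp_primitive (- y - 2 * d)
     - (ramp_primitive (y - d) - ramp_primitive (y - 2 * d))) / d.

(** The derivative of [soft_clamp d]: a trapezoid of height 1. *)
Definition dsoft_clamp (d y : R) : R :=
  1 + (ramp (- y - 2 * d) - ramp (- y - d)
     - (ramp (y - d) - ramp (y - 2 * d))) / d.

Lemma soft_clamp_id d y : 0 < d -> `|y| <= d -> soft_clamp d y = y.
Proof.
move=> d0; rewrite ler_norml => /andP[y1 y2].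
by rewrite /soft_clamp /ramp_primitive !ramp_eq0; lra.
Qed.

Lemma soft_clamp_le d y : 0 < d -> `|soft_clamp d y| <= 2 * d.
Proof.
move=> d0; rewrite -(ler_pM2r d0) -[X in _ * X]gtr0_norm // -normrM.
rewrite /soft_clamp mulrDl divfK ?gt_eqF // /ramp_primitive ler_norml.
case: (rampP (- y - d)) => -[h1 ->]; case: (rampP (- y - 2 * d)) => -[h2 ->];
  case: (rampP (y - d)) => -[h3 ->]; case: (rampP (y - 2 * d)) => -[h4 ->];
  by apply/andP; split; nra.
Qed.

Lemma continuous_reflect_shift (h : R -> R) c : continuous h ->
  continuous (fun z => h (- z - c)) /\ continuous (fun z => h (z - c)).
Proof.
move=> ch; split=> y.
  apply: (@continuous_comp _ _ _ (fun z => - z - c) h); last exact: ch.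
  by apply: cvgB; [apply: cvgN; exact: cvg_id|exact: cvg_cst].
apply: (@continuous_comp _ _ _ (fun z => z - c) h); last exact: ch.
by apply: cvgB; [exact: cvg_id|exact: cvg_cst].
Qed.

Lemma ramp_primitive_continuous : continuous ramp_primitive.
Proof.
move=> u; apply: cvgM; last exact: cvg_cst.
by apply: cvgM; exact: ramp_continuous.
Qed.

Lemma soft_clamp_continuous d : continuous (soft_clamp d).
Proof.
have cs c := continuous_reflect_shift c ramp_primitive_continuous.
move=> y; apply: cvgD; first exact: cvg_id.
apply: cvgM; last exact: cvg_cst.
by apply: cvgB; apply: cvgB; [exact: (cs _).1|exact: (cs _).1
  |exact: (cs _).2|exact: (cs _).2].
Qed.

Lemma dsoft_clamp_continuous d : continuous (dsoft_clamp d).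
Proof.
have cs c := continuous_reflect_shift c ramp_continuous.
move=> y; apply: cvgD; first exact: cvg_cst.
apply: cvgM; last exact: cvg_cst.
by apply: cvgB; apply: cvgB; [exact: (cs _).1|exact: (cs _).1
  |exact: (cs _).2|exact: (cs _).2].
Qed.

Lemma dsoft_clamp_bound d y : 0 < d -> `|dsoft_clamp d y| <= 1.
Proof.
move=> d0; rewrite -(ler_pM2r d0) -[X in _ * X]gtr0_norm // -normrM.
rewrite /dsoft_clamp mulrDl divfK ?gt_eqF // !mul1r ler_norml.
case: (rampP (- y - d)) => -[h1 ->]; case: (rampP (- y - 2 * d)) => -[h2 ->];
  case: (rampP (y - d)) => -[h3 ->]; case: (rampP (y - 2 * d)) => -[h4 ->];
  by apply/andP; split; lra.
Qed.

(** The remainder is [d^-1] times a signed sum of four remainders of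
    [ramp_primitive], each at most [b ^+ 2 / 2]. *)
Lemma soft_clamp_quadratic d a b : 0 < d ->
  `|soft_clamp d (a + b) - soft_clamp d a - dsoft_clamp d a * b|
     <= 2 / d * b ^+ 2.
Proof.
move=> d0.
pose r u v := ramp_primitive (u + v) - ramp_primitive u - ramp u * v.
have -> : soft_clamp d (a + b) - soft_clamp d a - dsoft_clamp d a * b =
  (r (- a - d) (- b) - r (- a - 2 * d) (- b)
     - (r (a - d) b - r (a - 2 * d) b)) / d.
  rewrite /r /soft_clamp /dsoft_clamp.
  have -> : - (a + b) - d = - a - d + - b by ring.
  have -> : - (a + b) - 2 * d = - a - 2 * d + - b by ring.
  have -> : (a + b) - d = a - d + b by ring.
  have -> : (a + b) - 2 * d = a - 2 * d + b by ring.
  by field; rewrite gt_eqF.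
have rb u v : `|r u v| <= v ^+ 2 / 2 by exact: ramp_primitive_quadratic.
rewrite normrM normfV [`|d|]gtr0_norm // mulrAC ler_pM2r ?invr_gt0 //.
have := rb (- a - d) (- b); have := rb (- a - 2 * d) (- b).
have := rb (a - d) b; have := rb (a - 2 * d) b.
rewrite sqrrN !ler_norml => /andP[? ?] /andP[? ?] /andP[? ?] /andP[? ?].
by apply/andP; split; lra.
Qed.

End soft_clamp.

(** * Differential calculus on [[0, 1]] *)

#[local] Existing Instance I01_dnbhs_proper.

Section calculus01.
Context {R : realType}.
Local Notation I01 := (I01 R).

Lemma diff_quot01_cvg (f : I01 -> R) t l :
  diff_quot01 f t s @[s --> t^'] --> l -> derivable01 f t /\ deriv01 f t = l.
Proof.
by move=> fl; split; [apply/cvg_ex; exists l|exact: (cvg_lim _ fl)].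
Qed.

Lemma cvg_dnbhs (T : Type) (U : topologicalType) (F : set_system T)
    (h : T -> U) (l : U) : Filter F -> h x @[x --> F] --> l ->
  (\forall x \near F, h x != l) -> h x @[x --> F] --> l^'.
Proof.
move=> FF hl hN W lW; have := hl _ lW.
by rewrite /nbhs /=; apply: filterS2 hN => x xN /(_ xN).
Qed.

Lemma clamp01_subproof (u : R) : Num.max 0 (Num.min u 1) \in `[0, 1]%classic.
Proof.
apply/mem_set; rewrite /= in_itv /= le_max lexx ge_max ler01 ge_min lexx orbT.
by [].
Qed.

(** The retraction of the line onto [[0, 1]] transports functions on [[0, 1]] to
    functions on the line, to which the theorems of real analysis apply. *)
Definition clamp01 (u : R) : I01 := SigSub (clamp01_subproof u).

Lemma val_clamp01 u : 0 <= u <= 1 -> \val (clamp01 u) = u.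
Proof. by move=> /andP[u0 u1] /=; rewrite min_l // max_r. Qed.

Lemma val01_itv (t : I01) : 0 <= \val t <= 1.
Proof. by have := set_valP t; rewrite /= in_itv. Qed.

Lemma clamp01K (t : I01) : clamp01 (\val t) = t.
Proof. by apply/val_inj; rewrite val_clamp01 // val01_itv. Qed.

Lemma clamp01_continuous : continuous clamp01.
Proof.
apply: continuous_comp_initial => u.
apply: (@continuous_max R R (cst 0) (fun u => Num.min u 1)).
  exact: cst_continuous.
by apply: (@continuous_min R R id (cst 1)); [exact: cvg_id|exact: cst_continuous].
Qed.

Lemma val01_cvg_dnbhs (t : I01) : \val s - \val t @[s --> t^'] --> (0 : R)^'.
Proof.
apply: cvg_dnbhs.
  have : \val s - \val t @[s --> t^'] --> \val t - \val t.
    apply: cvgB; last exact: cvg_cst.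
    by apply: cvg_within_filter; exact: I01_val_cvg.
  by rewrite subrr.
have : \forall s \near t^', s != t by exact: nbhs_dnbhs_neq.
by apply: filterS => s; apply: contra; rewrite subr_eq0 => /eqP/val_inj ->.
Qed.

Lemma derivable_deriv01 (F : R -> R) (t : I01) : derivable F (\val t) 1 ->
  derivable01 (F \o \val) t /\ deriv01 (F \o \val) t = 'D_1 F (\val t).
Proof.
move=> dF; apply: diff_quot01_cvg.
have := cvg_comp _ _ (@val01_cvg_dnbhs t) dF.
apply: cvg_trans; apply: near_eq_cvg; apply: nearW => s /=.
by rewrite /diff_quot01 /= /shift /= /GRing.scale /= mulr1 subrK mulrC.
Qed.

(** Integrate the extension [f \o clamp01], which is continuous on the whole
    line. *)
Lemma exists_primitive01 (f : I01 -> R) (c : R) : continuous f ->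
  exists2 F : I01 -> R, F (clamp01 0) = c &
    forall t, derivable01 F t /\ deriv01 F t = f t.
Proof.
move=> cf; pose g : R -> R := f \o clamp01.
have cg : continuous g.
  by move=> u; apply: continuous_comp; [exact: clamp01_continuous|exact: cf].
(* starting at -1 and stopping at 2 makes both endpoints of [0, 1] interior *)
pose G := fun x : R => (\int[lebesgue_measure]_(u in `[-1, x]) g u)%R.
have dG t : 0 <= t <= 1 -> derivable G t 1 /\ 'D_1 G t = g t.
  move=> /andP[t0 t1]; rewrite -derive1E.
  apply: (@continuous_FTC1_closed _ _ _ _ 2).
  - by lra.
  - apply: continuous_compact_integrable; first exact: segment_compact.
    exact: continuous_subspaceT.
  - by lra.
  - exact: cg.
pose G' u := G u + (c - G 0).
exists (G' \o \val) => [|t].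
  by rewrite /comp /G' val_clamp01 ?lexx ?ler01 // subrKC.
have [dGt G't] := dG _ (val01_itv t).
have dG't : is_derive (\val t) 1 G' ('D_1 G (\val t)).
  rewrite -[X in is_derive _ _ _ X]addr0.
  by apply: is_deriveD; exact: derivableP.
have [|? ->] := @derivable_deriv01 G' t; first exact: ex_derive.
by split => //; rewrite derive_val G't /g /= clamp01K.
Qed.

Lemma mean_value01 (F : I01 -> R) (t : I01) : (forall s, derivable01 F s) ->
  exists c, F t - F (clamp01 0) = deriv01 F c * \val t.
Proof.
move=> dF; pose G := F \o clamp01.
have cF : continuous F by move=> s; exact: derivable01_continuous.
have dG u : u \in `]0, \val t[ -> is_derive u 1 G (deriv01 F (clamp01 u)).
  rewrite in_itv /= => /andP[u0 ut].
  have [_ t1] := andP (val01_itv t).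
  have uE : \val (clamp01 u) = u.
    by rewrite val_clamp01 // !ltW // (lt_le_trans ut).
  have near_itv : \forall h \near (0 : R)^', 0 <= h + u <= 1.
    near=> h.
    have : `|h| < u by near: h; exact: dnbhs0_lt.
    have : `|h| < 1 - u.
      by near: h; apply: dnbhs0_lt; rewrite subr_gt0 (lt_le_trans ut).
    by rewrite !ltr_norml => /andP[? ?] /andP[? ?]; apply/andP; split; lra.
  have clamp_cvg : clamp01 (h + u) @[h --> (0 : R)^'] --> (clamp01 u)^'.
    apply: cvg_dnbhs.
      have : clamp01 (h + u) @[h --> (0 : R)] --> clamp01 (0 + u).
       apply: (@continuous_comp _ _ _ (fun h => h + u) clamp01).
         by apply: cvgD; [exact: cvg_id|exact: cvg_cst].
        exact: clamp01_continuous.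
      by rewrite add0r; exact: cvg_within_filter.
    near=> h; have h0 : h != 0 by near: h; exact: nbhs_dnbhs_neq.
    apply: contra h0 => /eqP/(congr1 \val); rewrite uE val_clamp01; last first.
      by near: h.
    by rewrite -[RHS]add0r => /addIr ->.
  have dG : h^-1 *: ((G \o shift u) (h *: 1) - G u) @[h --> (0 : R)^'] -->
      deriv01 F (clamp01 u).
    have := cvg_comp _ _ clamp_cvg (dF (clamp01 u)).
    apply: cvg_trans; apply: near_eq_cvg; near=> h.
    rewrite /= /diff_quot01 uE val_clamp01; last by near: h.
    by rewrite /G /= /shift /= /GRing.scale /= mulr1 addrK mulrC.
  by apply: DeriveDef; [apply/cvg_ex; eexists; exact: dG|exact: (cvg_lim _ dG)].
have [_ t1] := andP (val01_itv t).
have [||c _ GE] :=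
  @MVT_segment R G (fun u => deriv01 F (clamp01 u)) 0 (\val t) _ dG.
- by have /andP[] := val01_itv t.
- apply: continuous_subspaceT => u; apply: continuous_comp => //.
    exact: clamp01_continuous.
  exact: cF.
by exists (clamp01 c); move: GE; rewrite /G /= clamp01K subr0.
Unshelve. all: by end_near. Qed.

End calculus01.

(** * Coordinates on C^q *)

Section jets.
Context {R : realType}.
Local Notation I01 := (I01 R).

(** The point at which the j-th derivative is read off.  With it, both kinds of
    coordinates of [f] are written [derivn01 j f (node q j t)]: the number
    f^(j)(0) for [j < q], whatever [t] is, and the function f^(q) for
    [j = q]. *)
Definition node (q j : nat) (t : I01) : I01 :=
  if (j < q)%N then clamp01 0 else t.

Lemma derivn01S j (f : I01 -> R) : derivn01 j.+1 f = derivn01 j (deriv01 f).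
Proof. exact: iterSr. Qed.

(** Integrate [q] times, with the prescribed values at 0. *)
Lemma exists_jet q (G : nat -> I01 -> R) : continuous (G q) ->
  exists2 f : I01 -> R, is_Cq q f &
    forall j t, (j <= q)%N -> derivn01 j f (node q j t) = G j (node q j t).
Proof.
elim: q G => [|q IHq] G cG.
  by exists (G 0) => // j t; rewrite leqn0 => /eqP ->.
have [g Cg gG] := IHq (fun j => G j.+1) cG.
have [f f0 df] := exists_primitive01 (G 0 (clamp01 0)) (is_Cq_cont Cg (leq0n q)).
have f'E : deriv01 f = g by apply/funext => t; have [] := df t.
exists f; last by case=> [|j] t jq; rewrite ?derivn01S ?f'E /node ?ltnS //;
  exact: gG.
split=> [[|j] jq t|]; rewrite ?derivn01S ?f'E; [by have [] := df t| |exact: Cg.2].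
exact: Cg.1.
Qed.

(** By the mean value theorem, passing from the derivative of order [j.+1] to
    the one of order [j] adds at most the value at 0, that is, [M]. *)
Lemma Cq_norm_jet_le q (f : I01 -> R) (M : R) : is_Cq q f ->
  (forall j t, (j <= q)%N -> `|derivn01 j f (node q j t)| <= M) ->
  Cq_norm q f <= q.+1%:R * M.
Proof.
move=> Cf jM.
have M0 : 0 <= M by apply: le_trans (jM q (clamp01 0) (leqnn q)).
have bound k : (k <= q)%N -> forall t, `|derivn01 (q - k) f t| <= k.+1%:R * M.
  elim: k => [_ t|k IHk kq t].
    by have := jM q t (leqnn q); rewrite /node ltnn subn0 mul1r.
  have jq : (q - k.+1 < q)%N by rewrite ltn_subrL (leq_trans _ kq).
  have [c cE] := mean_value01 t (Cf.1 _ jq).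
  have /andP[t0 t1] := val01_itv t.
  rewrite -(subrK (derivn01 (q - k.+1) f (clamp01 0)) (derivn01 _ f t)) cE.
  rewrite (le_trans (ler_normD _ _)) // -natr1 mulrDl mul1r lerD //; last first.
    by have := jM _ t (ltnW jq); rewrite /node jq.
  rewrite normrM (ger0_norm t0) (le_trans (ler_piMr _ t1)) //.
  by have := IHk (ltnW kq) c; rewrite -(subnSK kq).
apply: Cq_norm_le => [|j t jq]; first by rewrite mulr_ge0.
rewrite -(subKn jq) (le_trans (bound _ (leq_subr j q) t)) //.
by rewrite ler_wpM2r // ler_nat ltnS leq_subr.
Qed.

End jets.

(** * Bounded local identities on C^q *)

Section Cq_blid.
Context {R : realType} {q : nat}.
Local Notation I01 := (I01 R).
Local Notation Cq := (Cq R q).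

Lemma derivn01_Cq_lin (a : R) (x y : Cq) j t : (j <= q)%N ->
  derivn01 j (a *: x + y : Cq) t = a * derivn01 j x t + derivn01 j y t.
Proof.
by move=> jq; have /= -> := derivn01_lin a (Cq_funP x) (Cq_funP y) jq.
Qed.

Lemma derivn01_CqB (x y : Cq) j t : (j <= q)%N ->
  derivn01 j (x - y : Cq) t = derivn01 j x t - derivn01 j y t.
Proof.
by move=> jq; rewrite -scaleN1r addrC derivn01_Cq_lin // mulN1r addrC.
Qed.

Lemma norm_jet_le (x : Cq) (M : R) :
  (forall j t, (j <= q)%N -> `|derivn01 j x (node q j t)| <= M) ->
  `|x| <= q.+1%:R * M.
Proof. exact: Cq_norm_jet_le (Cq_funP x). Qed.

Lemma le_norm_Cq (x : Cq) j t : (j <= q)%N -> `|derivn01 j x t| <= `|x|.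
Proof. exact: Cq_norm_ge (Cq_funP x). Qed.

Lemma jet_inj (x y : Cq) :
  (forall j t, (j <= q)%N ->
    derivn01 j x (node q j t) = derivn01 j y (node q j t)) -> x = y.
Proof.
move=> xy; apply/eqP; rewrite -subr_eq0 -normr_le0 -(mulr0 q.+1%:R).
apply: norm_jet_le => j t jq.
by rewrite derivn01_CqB // xy // subrr normr0.
Qed.

Lemma exists_Cq_jet (G : nat -> I01 -> R) : continuous (G q) ->
  exists x : Cq, forall j t, (j <= q)%N ->
    derivn01 j x (node q j t) = G j (node q j t).
Proof.
by move=> cG; have [f /mem_set Cf fG] := exists_jet cG; exists (MkCq Cf).
Qed.

(** [H] applies [soft_clamp d] to every coordinate, and its derivative at [x]
    multiplies the coordinates of the increment by the values of
    [dsoft_clamp d] at those of [x].  All the estimates are made coordinate by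
    coordinate. *)
Lemma small_blids_Cq : small_blids Cq.
Proof.
move=> e e0.
(* coordinates at most [2 * d] give norm at most [q.+1%:R * (2 * d) = e / 2] *)
pose d := e / (4 * q.+1%:R).
have d0 : 0 < d by rewrite divr_gt0 // mulr_gt0.
have cx (x : Cq) : continuous (derivn01 q x) := (Cq_funP x).2.
have [|H HE] := choice (P := fun x y : Cq => forall j t, (j <= q)%N ->
    derivn01 j y (node q j t) = soft_clamp d (derivn01 j x (node q j t))).
  move=> x; apply: (@exists_Cq_jet (fun j t => soft_clamp d (derivn01 j x t))).
  move=> t; apply: (@continuous_comp _ _ _ (derivn01 q x) (soft_clamp d)).
    exact: cx.
  exact: soft_clamp_continuous.
exists H; split=> [x||x].
- have [|A AE] := choice (P := fun k y : Cq => forall j t, (j <= q)%N ->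
      derivn01 j y (node q j t) = dsoft_clamp d (derivn01 j x (node q j t)) *
        derivn01 j k (node q j t)).
    have cd : continuous (fun t => dsoft_clamp d (derivn01 q x t)).
      move=> t; apply: (@continuous_comp _ _ _ (derivn01 q x) (dsoft_clamp d)).
        exact: cx.
      exact: dsoft_clamp_continuous.
    move=> k; apply: (@exists_Cq_jet (fun j t =>
      dsoft_clamp d (derivn01 j x t) * derivn01 j k t)) => t.
    have F : Filter (nbhs t) by exact: nbhs_filter.
    exact: (cvgM (FF := F) (cd t) (cx k t)).
  have linA : linear A.
    move=> a k l; apply: jet_inj => j t jq.
    by rewrite derivn01_Cq_lin // !AE // derivn01_Cq_lin //; ring.
  pose AL : {linear Cq -> Cq} := HB.pack A (GRing.isLinear.Build _ _ _ _ A linA).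
  apply: (@quadratic_bounded_differentiable _ _ _ H x AL (q.+1%:R * (2 / d))).
    apply: bounded_linear_continuous; rewrite /bounded_near; near=> M.
    have : \forall k \near (0 : Cq), `|k| <= 1 by exact: nbhs0_le.
    apply: filterS => k k1 /=; apply: le_trans (_ : q.+1%:R * 1 <= M).
      apply: norm_jet_le => j t jq; rewrite AE // normrM -[leRHS]mulr1.
      apply: ler_pM => //; first exact: dsoft_clamp_bound.
      exact: le_trans (le_norm_Cq _ _ jq) k1.
    by near: M; exact: nbhs_pinfty_ge.
  move=> k; rewrite -mulrA; apply: norm_jet_le => j t jq.
  rewrite !derivn01_CqB // !HE // /AL /= AE //.
  have -> : derivn01 j (x + k : Cq) (node q j t) =
      derivn01 j x (node q j t) + derivn01 j k (node q j t).
    by rewrite -[x in LHS]scale1r derivn01_Cq_lin // mul1r.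
  apply: le_trans (soft_clamp_quadratic _ _ d0) _.
  apply: ler_wpM2l; first by rewrite divr_ge0 // ltW.
  rewrite -[X in X <= _]ger0_norm ?sqr_ge0 // normrX.
  by rewrite ler_pXn2r ?nnegrE // le_norm_Cq.
- near=> x; apply: jet_inj => j t jq; rewrite HE // soft_clamp_id //.
  apply: le_trans (le_norm_Cq _ _ jq) _; near: x.
  exact: nbhs0_le.
- apply: le_lt_trans (norm_jet_le (M := 2 * d) _) _ => [j t jq|].
    by rewrite HE //; exact: soft_clamp_le.
  have -> : q.+1%:R * (2 * d) = e / 2.
    by rewrite /d; field; rewrite nat1r pnatr_eq0.
  by rewrite ltr_pdivrMr // ltr_pMr // ltr1n.
Unshelve. all: by end_near. Qed.

End Cq_blid.

Theorem corollary4p7 (R : realType) (q : nat) (hq : (0 < q)%N)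
    (Y : topologicalLmodType R) :
  (forall G : germ (Cq R q) Y,
     differentiable_germ bounded_differentiable_at G ->
     has_global_differentiable_representative bounded_differentiable_at G) /\
  (forall G : germ (Cq R q) Y,
     differentiable_germ compact_differentiable_at G ->
     has_global_differentiable_representative compact_differentiable_at G).
Proof.
split=> G; apply: global_representative small_blids_Cq => D f H x dH df.
  by apply: bounded_differentiable_comp dH df; exact: filterT.
by apply: compact_differentiable_comp (bounded_compact_differentiable dH) df;
  exact: filterT.
Qed.
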